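(* Let $R$ be any totally ordered semi-ring. There is an absolute constant $\epsilon>0$ such that for all sufficiently large $n$, if the Hamiltonian Cycle polynomial $HC_n$ is a monotone affine projection of the permanent $\mathrm{perm}_m$ over $R$, then $m\geq 2^{\epsilon n}$. In particular, the family $(HC_n)$ is not a monotone affine p-projection of the family $(\mathrm{perm}_m)$.
   Context: A (commutative) totally ordered semi-ring is a totally ordered set $(R,\leq)$ with operations $\times,+$ and elements $1\neq 0$ such that $(R,\times,1)$, $(R,+,0)$ are commutative monoids, $\times$ distributes over $+$, $0\times a=0$, $a+c\leq b+c$ whenever $a\leq b$, and $ac\leq bc$ whenever $a\leq b$ and $0\leq c$. Examples: $(\mathbb{R},\times,+)$, the tropical semi-ring $(\mathbb{R},+,\min)$, the Boolean semi-ring $(\{0,1\},\wedge,\vee)$. An element $c$ is non-negative if $0\leq c$. Polynomials are formal polynomials over $R$. The permanent is $\mathrm{perm}_m(Y)=\sum_{\pi\in S_m} y_{1,\pi(1)}\cdots y_{m,\pi(m)}$ in the $m^2$ variables $y_{ij}$. The Hamiltonian Cycle polynomial is $HC_n(X)=\sum_{\sigma} x_{1,\sigma(1)}\cdots x_{n,\sigma(n)}$ in variables $x_{ij}$ ($i,j\in[n]$), the sum over all permutations $\sigma\in S_n$ that are $n$-cycles. A polynomial $f(x_1,\dots,x_n)$ is a monotone affine projection of $g(y_1,\dots,y_m)$ if $f$ is obtained from $g$ by substituting for each $y_i$ an affine linear function $a_0+a_1x_1+\dots+a_nx_n$ with all $a_k\in R$ non-negative. A family $(f_n)$ is a monotone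 affine p-projection of $(g_m)$ if there is a polynomially bounded function $p$ with $f_n$ a monotone affine projection of $g_{p(n)}$ for all sufficiently large $n$. *)

(* Defs.v *)
From HB Require Import structures.
From mathcomp Require Import all_boot all_fingroup all_algebra finmap.

Set Implicit Arguments.
Unset Strict Implicit.
Unset Printing Implicit Defensive.

Import GRing.Theory.

Local Open Scope ring_scope.

(* The order is carried as an explicit relation: the order structures of the
   library that are compatible with addition presuppose an additive group. *)
Record toSemiRing := TOSemiRing {
  tosr_sort :> comNzSemiRingType;
  tosr_le : rel tosr_sort;
  tosr_le_refl : reflexive tosr_le;
  tosr_le_anti : antisymmetric tosr_le;
  tosr_le_trans : transitive tosr_le;
  tosr_le_total : total tosr_le;
  tosr_leD2r : forall a b c, tosr_le a b -> tosr_le (a + c) (b + c);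
  tosr_leM2r : forall a b c,
    tosr_le a b -> tosr_le 0 c -> tosr_le (a * c) (b * c)
}.

(* Formal polynomials over a semi-ring R, in variables indexed by a finite
   type I: finitely supported maps from exponent vectors to coefficients. *)
Definition mvmonom (I : finType) := {ffun I -> nat}.

Definition mvpoly (I : finType) (R : comNzSemiRingType) :=
  {fsfun mvmonom I -> R with 0}.

HB.instance Definition _ (I : finType) (R : comNzSemiRingType) :=
  Choice.copy (mvpoly I R) {fsfun mvmonom I -> R with 0}.

Section MvPoly.
Variables (I : finType) (R : comNzSemiRingType).
Implicit Types (p q r : mvpoly I R) (a b : mvmonom I) (c : R).

Definition mvcoef a p : R := (p : {fsfun mvmonom I -> R with 0}) a.
Definition mvsupp p : {fset mvmonom I} :=
  finsupp (p : {fsfun mvmonom I -> R with 0}).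

Lemma mvcoefP p q : (forall a, mvcoef a p = mvcoef a q) -> p = q.
Proof. by move=> pq; apply/fsfunP => a; apply: pq. Qed.

Lemma mvcoef_out a p : a \notin mvsupp p -> mvcoef a p = 0.
Proof. exact: fsfun_dflt. Qed.

(* The monomial c * x^a. *)
Definition mvterm a c : mvpoly I R := [fsfun b in [fset a]%fset => c | 0].

Lemma mvcoef_term a c b : mvcoef b (mvterm a c) = if b == a then c else 0.
Proof. by rewrite /mvcoef fsfunE inE. Qed.

Definition mvzero : mvpoly I R := [fsfun with 0].
Definition mvadd p q : mvpoly I R :=
  [fsfun a in (mvsupp p `|` mvsupp q)%fset => mvcoef a p + mvcoef a q | 0].

Lemma mvcoef_zero a : mvcoef a mvzero = 0.
Proof. by rewrite /mvcoef fsfunE. Qed.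

Lemma mvcoef_add a p q : mvcoef a (mvadd p q) = mvcoef a p + mvcoef a q.
Proof.
rewrite {1}/mvcoef fsfunE inE; case: ifPn => //.
by rewrite negb_or => /andP[/mvcoef_out-> /mvcoef_out->]; rewrite addr0.
Qed.

Fact mvaddA : associative mvadd.
Proof. by move=> p q r; apply: mvcoefP => a; rewrite !mvcoef_add addrA. Qed.

Fact mvaddC : commutative mvadd.
Proof. by move=> p q; apply: mvcoefP => a; rewrite !mvcoef_add addrC. Qed.

Fact mvadd0 : left_id mvzero mvadd.
Proof. by move=> p; apply: mvcoefP => a; rewrite mvcoef_add mvcoef_zero add0r. Qed.

HB.instance Definition _ :=
  GRing.isNmodule.Build (mvpoly I R) mvaddA mvaddC mvadd0.

Lemma mvcoefD a p q : mvcoef a (p + q) = mvcoef a p + mvcoef a q.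
Proof. exact: mvcoef_add. Qed.

Lemma mvcoef0 a : mvcoef a (0 : mvpoly I R) = 0.
Proof. exact: mvcoef_zero. Qed.

Lemma mvtermD a c c' : mvterm a (c + c') = mvterm a c + mvterm a c'.
Proof.
apply: mvcoefP => b; rewrite mvcoefD !mvcoef_term.
by case: eqP; rewrite ?addr0.
Qed.

Lemma mvterm0 a : mvterm a 0 = 0.
Proof. by apply: mvcoefP => b; rewrite mvcoef_term mvcoef0; case: eqP. Qed.

Lemma mvcoef_sum (J : Type) (s : seq J) (F : J -> mvpoly I R) a :
  mvcoef a (\sum_(j <- s) F j) = \sum_(j <- s) mvcoef a (F j).
Proof.
by elim/big_rec2: _ => [|j x y _ <-]; rewrite ?mvcoef0 // mvcoefD.
Qed.

(* Bilinear extension of (c x^a)(c' x^b) = (c c') x^(a+b). *)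
Definition mvmul p q : mvpoly I R :=
  \sum_(a <- mvsupp p) \sum_(b <- mvsupp q)
     mvterm (a + b) (mvcoef a p * mvcoef b q).

Definition mvone : mvpoly I R := mvterm 0 1.

Lemma mvsupp_widen (V : nmodType) (D : {fset mvmonom I}) p
    (F : mvmonom I -> R -> V) :
    (forall a, F a 0 = 0) -> (mvsupp p `<=` D)%fset ->
  \sum_(a <- mvsupp p) F a (mvcoef a p) = \sum_(a <- D) F a (mvcoef a p).
Proof.
move=> F0 pD; apply: big_fset_incl => // a _ /mvcoef_out->.
exact: F0.
Qed.

Lemma mvsuppD p q (V : nmodType) (F : mvmonom I -> R -> V) :
    (forall a, F a 0 = 0) -> (forall a c c', F a (c + c') = F a c + F a c') ->
  \sum_(a <- mvsupp (p + q)) F a (mvcoef a (p + q)) =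
  \sum_(a <- mvsupp p) F a (mvcoef a p) + \sum_(a <- mvsupp q) F a (mvcoef a q).
Proof.
move=> F0 FD; pose D := (mvsupp p `|` mvsupp q `|` mvsupp (p + q)%R)%fset.
have pD : (mvsupp p `<=` D)%fset by rewrite /D -fsetUA fsubsetUl.
have qD : (mvsupp q `<=` D)%fset by rewrite /D fsetUAC fsubsetUr.
have sD : (mvsupp (p + q)%R `<=` D)%fset by rewrite /D fsubsetUr.
rewrite (mvsupp_widen F0 pD) (mvsupp_widen F0 qD) (mvsupp_widen F0 sD).
by rewrite -big_split; apply: eq_bigr => a _; rewrite mvcoefD FD.
Qed.

Lemma mvsupp_term a c (V : nmodType) (F : mvmonom I -> R -> V) :
    (forall b, F b 0 = 0) ->
  \sum_(b <- mvsupp (mvterm a c)) F b (mvcoef b (mvterm a c)) = F a c.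
Proof.
move=> F0; rewrite (@mvsupp_widen _ [fset a]%fset) //.
  by rewrite big_seq_fset1 mvcoef_term eqxx.
apply/fsubsetP => b; rewrite inE; apply: contraTT => ba.
by rewrite mem_finsupp -/(mvcoef _ _) mvcoef_term (negPf ba) eqxx.
Qed.

Lemma mvpolyE p : p = \sum_(a <- mvsupp p) mvterm a (mvcoef a p).
Proof.
apply: mvcoefP => b; rewrite mvcoef_sum.
under eq_bigr do rewrite mvcoef_term.
have [bp|bNp] := boolP (b \in mvsupp p).
  rewrite (big_fsetD1 b) //= eqxx big1_seq ?addr0 // => a /=.
  by rewrite !inE eq_sym => /andP[/negPf->].
rewrite mvcoef_out // big1_seq // => a /= ap.
by case: eqP => // ba; rewrite ba ap in bNp.
Qed.

Lemma mvpoly_ind (P : mvpoly I R -> Prop) :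
    P 0 -> (forall p q, P p -> P q -> P (p + q)) ->
    (forall a c, P (mvterm a c)) -> forall p, P p.
Proof. by move=> P0 PD PT p; rewrite (mvpolyE p); apply: big_ind. Qed.

Fact mvmulC : commutative mvmul.
Proof.
move=> p q; rewrite /mvmul exchange_big; apply: eq_bigr => b _.
by apply: eq_bigr => a _; rewrite addrC mulrC.
Qed.

Fact mvmulDl : left_distributive mvmul +%R.
Proof.
move=> p q r; rewrite /mvmul.
rewrite (@mvsuppD p q _ (fun a x => \sum_(b <- mvsupp r)
  mvterm (a + b) (x * mvcoef b r))) // => [a|a x y].
  by rewrite big1 // => b _; rewrite mul0r mvterm0.
by rewrite -big_split; apply: eq_bigr => b _; rewrite mulrDl mvtermD.
Qed.

Fact mvmul0 : left_zero 0 mvmul.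
Proof.
move=> p; rewrite /mvmul big1_seq // => a /= _.
by rewrite big1 // => b _; rewrite mvcoef0 mul0r mvterm0.
Qed.

Lemma mvmulDr : right_distributive mvmul +%R.
Proof. by move=> p q r; rewrite !(mvmulC p) mvmulDl. Qed.

Lemma mvmul_term a b c c' :
  mvmul (mvterm a c) (mvterm b c') = mvterm (a + b) (c * c').
Proof.
rewrite /mvmul (@mvsupp_term a c _ (fun a x => \sum_(b <- mvsupp _)
  mvterm (a + b) (x * mvcoef b _))) => [|d].
  by rewrite (@mvsupp_term b c' _ (fun b x => mvterm (a + b) (c * x))) // => d;
    rewrite mulr0 mvterm0.
by rewrite big1 // => e _; rewrite mul0r mvterm0.
Qed.

Fact mvmulA : associative mvmul.
Proof.
move=> p q r; elim/mvpoly_ind: p => [|p p' IH IH'|a c].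
- by rewrite !mvmul0.
- by rewrite !mvmulDl IH IH'.
elim/mvpoly_ind: q => [|q q' IH IH'|b c'].
- by rewrite (mvmulC _ 0) !mvmul0 (mvmulC _ 0) !mvmul0.
- by rewrite mvmulDl mvmulDr IH IH' mvmulDr mvmulDl.
elim/mvpoly_ind: r => [|r r' IH IH'|d c''].
- by rewrite !(mvmulC _ 0) !mvmul0 (mvmulC _ 0) mvmul0.
- by rewrite !mvmulDr IH IH'.
by rewrite !mvmul_term addrA mulrA.
Qed.

Fact mvmul1 : left_id mvone mvmul.
Proof.
elim/mvpoly_ind => [|p q IH IH'|a c].
- by rewrite mvmulC mvmul0.
- by rewrite mvmulDr IH IH'.
by rewrite mvmul_term add0r mul1r.
Qed.

Fact mvone_neq0 : mvone != 0.
Proof.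
apply/eqP => /(congr1 (mvcoef 0)) /eqP.
by rewrite mvcoef_term mvcoef0 eqxx (negPf (oner_neq0 R)).
Qed.

HB.instance Definition _ := GRing.Nmodule_isComNzSemiRing.Build (mvpoly I R)
  mvmulA mvmulC mvmul1 mvmulDl mvmul0 mvone_neq0.

Definition mvC c : mvpoly I R := mvterm 0 c.
Definition mvX (i : I) : mvpoly I R :=
  mvterm [ffun j => (j == i : nat)] 1.

End MvPoly.

(* g with each variable y_j replaced by the polynomial u j. *)
Definition mvsubst (I J : finType) (R : comNzSemiRingType)
    (g : mvpoly J R) (u : J -> mvpoly I R) : mvpoly I R :=
  \sum_(a <- mvsupp g)
     mvC I (mvcoef a g) * \prod_(j : J) u j ^+ (a : {ffun J -> nat}) j.

Definition mvaffine (I : finType) (R : comNzSemiRingType)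
    (a0 : R) (a : I -> R) : mvpoly I R :=
  mvC I a0 + \sum_(i : I) mvC I (a i) * mvX R i.

Definition monotone_affine_projection (R : toSemiRing) (I J : finType)
    (f : mvpoly I R) (g : mvpoly J R) : Prop :=
  exists (a0 : J -> R) (a : J -> I -> R),
    [/\ forall j, tosr_le 0 (a0 j),
        forall j i, tosr_le 0 (a j i)
      & f = mvsubst g (fun j => mvaffine (a0 j) (a j))].

Definition polynomially_bounded (p : nat -> nat) : Prop :=
  exists c : nat, forall n, (p n <= n ^ c + c)%N.

Definition monotone_affine_p_projection (R : toSemiRing)
    (I J : nat -> finType)
    (f : forall n, mvpoly (I n) R) (g : forall m, mvpoly (J m) R) : Prop :=
  exists p : nat -> nat, polynomially_bounded p /\
    exists n0 : nat, forall n, (n0 <= n)%N ->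
      monotone_affine_projection (f n) (g (p n)).

Definition perm_poly (R : comNzSemiRingType) (m : nat) :
    mvpoly ('I_m * 'I_m)%type R :=
  \sum_(s : 'S_m) \prod_(i < m) mvX R (i, s i).

Definition full_cycle (n : nat) (s : 'S_n) : bool := porbits s == [set setT].

Definition HC_poly (R : comNzSemiRingType) (n : nat) :
    mvpoly ('I_n * 'I_n)%type R :=
  \sum_(s : 'S_n | full_cycle s) \prod_(i < n) mvX R (i, s i).

(* Main.v *)
Require Import Defs.
From mathcomp Require Import all_boot all_order all_fingroup all_algebra.
From mathcomp Require Import finmap boolp reals exp zify.

(** In a totally ordered semi-ring the nilpotents form a prime ideal of the
    non-negative cone, so "not nilpotent" is a homomorphism from this cone to
    the Booleans. Hence only supports matter: a monotone projection of
    [HC_n] from [perm_m] is an [m x m] bipartite multigraph with edges labelled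
    by monomials, in which every perfect matching has a Hamiltonian cycle as
    its total label and every Hamiltonian cycle occurs.

    Restricting to a sparse digraph on about [4 k] vertices, whose Hamiltonian
    cycles either use none of [k ^ 2] distinguished arcs or use them along the
    graph of a permutation of [k] points, both possibilities occurring in all
    ways, turns [HC_n] into [1 + perm_k]. Fix a matching with label [1];
    relative to it the other matchings are families of disjoint cycles of a
    digraph on [m] vertices, and every simple cycle has label [1] or a full
    monomial of [perm_k]. So every closed walk has a product of monomials of
    [perm_k] as label: a constant term turns matchings into walks. Cut the cycle
    of a permutation [s] of [k = 2 h] points into two walks [x -> u] and
    [u -> x], the first carrying [h] variables. If [s] and [s'] share [(x, u)],
    the walks can be exchanged, and comparing degrees shows that the first walks
    use the same rows and the same columns. At most [h! ^ 2] permutations are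
    compatible with a given choice of rows and columns, so
    [(2 h)! <= m ^ 2 * h! ^ 2] and [2 ^ h <= m ^ 2]. *)

Set Implicit Arguments.
Unset Strict Implicit.
Unset Printing Implicit Defensive.

Import GRing.Theory.
Local Open Scope ring_scope.

(** * Supports of polynomials with non-negative coefficients *)

Section NonNilpotent.
Variable R : toSemiRing.
Implicit Types a b c : R.

Local Notation nonneg a := (tosr_le 0 a).
Definition nonnil a := ~~ `[< exists k, a ^+ k = 0 >].

Let letr b a c : tosr_le a b -> tosr_le b c -> tosr_le a c.
Proof. exact: tosr_le_trans. Qed.

Lemma nonneg0 : nonneg (0 : R). Proof. exact: tosr_le_refl. Qed.

Lemma nonnegD a b : nonneg a -> nonneg b -> nonneg (a + b).
Proof.
move=> a0 b0; apply: (letr b0).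
by rewrite -{1}(add0r b); exact: (tosr_leD2r b a0).
Qed.

Lemma nonnegM a b : nonneg a -> nonneg b -> nonneg (a * b).
Proof. by move=> a0 b0; rewrite -(mul0r b); apply: tosr_leM2r. Qed.

Lemma nonneg_sum (J : Type) (s : seq J) (P : pred J) (F : J -> R) :
  (forall j, P j -> nonneg (F j)) -> nonneg (\sum_(j <- s | P j) F j).
Proof.
move=> F0; apply: (big_ind (fun a : R => nonneg a)) => //.
  exact: nonneg0.
exact: nonnegD.
Qed.

Lemma nonnegX a k : nonneg a -> nonneg (a ^+ k.+1).
Proof.
move=> a0; elim: k => [|k IH]; first by rewrite expr1.
by rewrite exprS; apply: nonnegM.
Qed.

Lemma le_exp a b k : nonneg a -> tosr_le a b -> tosr_le (a ^+ k.+1) (b ^+ k.+1).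
Proof.
move=> a0 ab; have b0 : nonneg b := letr a0 ab.
elim: k => [|k IH]; first by rewrite !expr1.
rewrite (exprS a) (exprS b); apply: letr (tosr_leM2r ab (nonnegX k a0)) _.
by rewrite !(mulrC b); apply: tosr_leM2r.
Qed.

Lemma nonnilP a : reflect (forall k, a ^+ k <> 0) (nonnil a).
Proof.
apply: (iffP idP) => [/asboolPn H k E|H]; first by apply: H; exists k.
by apply/asboolPn => -[k /H].
Qed.

Lemma nonnilPn a : reflect (exists k, a ^+ k.+1 = 0) (~~ nonnil a).
Proof.
rewrite negbK; apply: (iffP idP) => [/asboolP[k ak]|[k ak]].
  by exists k; rewrite exprS ak mulr0.
by apply/asboolP; exists k.+1.
Qed.

Lemma nonnil0 : nonnil 0 = false.
Proof. by apply/negbTE/nonnilPn; exists 0%N; rewrite expr1. Qed.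

Lemma nonnil1 : nonnil 1.
Proof. by apply/nonnilP => k; rewrite expr1n; apply/eqP; exact: oner_neq0. Qed.

Lemma le_nonnil a b : nonneg a -> tosr_le a b -> nonnil a -> nonnil b.
Proof.
move=> a0 ab; apply: contraTT => /nonnilPn[k bk]; apply/nonnilPn; exists k.
apply: tosr_le_anti; rewrite -{1}bk le_exp //=; exact: nonnegX.
Qed.

Lemma nonnilMr a b : nonnil (a * b) -> nonnil a.
Proof.
by move=> /nonnilP H; apply/nonnilP => k ak; apply: (H k); rewrite exprMn ak mul0r.
Qed.

(** For [a <= b] one has [b <= a + b <= b + b], and [b + b] is a multiple of [b]. *)
Lemma nonnilD a b : nonneg a -> nonneg b -> nonnil (a + b) = nonnil a || nonnil b.
Proof.
wlog ab : a b / tosr_le a b => [H a0 b0|a0 b0].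
  by case/orP: (tosr_le_total a b) => ab; [|rewrite addrC orbC]; apply: H.
have -> : nonnil a || nonnil b = nonnil b.
  by case: (boolP (nonnil a)) => // /(le_nonnil a0 ab)->.
apply/idP/idP => [|]; last first.
  by apply: le_nonnil => //; rewrite -{1}(add0r b); apply: tosr_leD2r.
move=> /(le_nonnil (nonnegD a0 b0) (tosr_leD2r _ ab)).
by rewrite -mulr2n -mulr_natr => /nonnilMr.
Qed.

(* Comparability makes the ideal of nilpotents prime: if [a <= b] then
   [a ^+ 2 <= a * b]. *)
Lemma nonnilM a b : nonneg a -> nonneg b -> nonnil (a * b) = nonnil a && nonnil b.
Proof.
wlog ab : a b / tosr_le a b => [H a0 b0|a0 b0].
  by case/orP: (tosr_le_total a b) => ab; [|rewrite mulrC andbC]; apply: H.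
apply/idP/andP => [H|[/nonnilP Ha _]].
  by split; [|rewrite mulrC in H]; apply: nonnilMr H.
have : nonnil (a * a).
  by apply/nonnilP => k; rewrite -expr2 -exprM; apply: Ha.
apply: le_nonnil; first exact: nonnegM.
by rewrite (mulrC a b); apply: tosr_leM2r.
Qed.

Lemma nonnil_sum (J : eqType) (s : seq J) (P : pred J) (F : J -> R) :
    (forall j, P j -> nonneg (F j)) ->
  nonnil (\sum_(j <- s | P j) F j) = has (fun j => P j && nonnil (F j)) s.
Proof.
move=> F0; elim: s => [|j s IH] /=; first by rewrite big_nil nonnil0.
rewrite big_cons; case: ifP => //= Pj.
by rewrite nonnilD ?IH ?F0 //; apply: nonneg_sum.
Qed.

(** Covers the orders with [1] negative: multiplying [1 <= 0] by [a] gives [a <= 0]. *)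
Lemma nonneg_trivial a : ~~ nonneg (1 : R) -> nonneg a -> a = 0.
Proof.
move=> N1 a0; have /orP[/(negP N1)//|le10] := tosr_le_total (0 : R) 1.
apply: tosr_le_anti; apply/andP; split=> //.
by have := tosr_leM2r le10 a0; rewrite mul1r mul0r.
Qed.

End NonNilpotent.

Local Notation nonneg a := (tosr_le 0 a).

(** * Supports modulo nilpotents of sums, products and affine forms *)

Section Support.
Variables (I : finType) (R : toSemiRing).
Implicit Types (p q : mvpoly I R) (a b : mvmonom I).

Definition pnonneg p := forall a, nonneg (mvcoef a p).
(** Monomials with nilpotent coefficients are dropped, since [mvsupp] need not be multiplicative. *)
Definition psupp p a := nonnil (mvcoef a p).

Lemma pnonneg0 : pnonneg 0.
Proof. by move=> a; rewrite mvcoef0; apply: nonneg0. Qed.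

Lemma pnonnegD p q : pnonneg p -> pnonneg q -> pnonneg (p + q).
Proof. by move=> p0 q0 a; rewrite mvcoefD; apply: nonnegD. Qed.

Lemma pnonneg_term a (c : R) : nonneg c -> pnonneg (mvterm a c).
Proof. by move=> c0 b; rewrite mvcoef_term; case: ifP => // _; apply: nonneg0. Qed.

Lemma mvcoefM p q a : mvcoef a (p * q) =
  \sum_(b <- mvsupp p) \sum_(c <- mvsupp q)
    if a == b + c then mvcoef b p * mvcoef c q else 0.
Proof.
rewrite [p * q]/(mvmul p q) /mvmul mvcoef_sum; apply: eq_bigr => b _.
by rewrite mvcoef_sum; apply: eq_bigr => c _; rewrite mvcoef_term.
Qed.

Lemma pnonnegM p q : pnonneg p -> pnonneg q -> pnonneg (p * q).
Proof.
move=> p0 q0 a; rewrite mvcoefM; apply: nonneg_sum => b _.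
apply: nonneg_sum => c _; case: ifP => _; [exact: nonnegM|exact: nonneg0].
Qed.

Lemma psupp_in p a : psupp p a -> a \in mvsupp p.
Proof. by apply: contraTT => /mvcoef_out; rewrite /psupp => ->; rewrite nonnil0. Qed.

(** Nothing cancels: a sum of non-negative terms is nilpotent only if all its terms are, and a
    product only if one of its factors is. *)
Lemma psuppM p q a : pnonneg p -> pnonneg q ->
  psupp (p * q) a <-> exists b c, [/\ psupp p b, psupp q c & a = b + c].
Proof.
move=> p0 q0.
have nn b c : nonneg (if a == b + c then mvcoef b p * mvcoef c q else 0).
  by case: ifP => _; [exact: nonnegM|exact: nonneg0].
rewrite /psupp mvcoefM nonnil_sum => [|b _]; last by apply: nonneg_sum.
split=> [/hasP[/= b bp]|[b [c [pb qc abc]]]].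
  rewrite nonnil_sum // => /hasP[/= c cq].
  case: eqP => [->|_]; last by rewrite nonnil0.
  by rewrite nonnilM // => /andP[pb qc]; exists b, c.
apply/hasP; exists b => /=; first exact: psupp_in.
rewrite nonnil_sum //; apply/hasP; exists c => /=; first exact: psupp_in.
by rewrite abc eqxx nonnilM // pb.
Qed.

Lemma psuppD p q a : pnonneg p -> pnonneg q ->
  psupp (p + q) a = psupp p a || psupp q a.
Proof. by move=> p0 q0; rewrite /psupp mvcoefD nonnilD. Qed.

Lemma psupp_term a (c : R) b : psupp (mvterm a c) b = (b == a) && nonnil c.
Proof. by rewrite /psupp mvcoef_term; case: eqP; rewrite ?nonnil0. Qed.

Lemma pnonneg_sum (J : Type) (s : seq J) (P : pred J) (F : J -> mvpoly I R) :
  (forall j, P j -> pnonneg (F j)) -> pnonneg (\sum_(j <- s | P j) F j).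
Proof. by move=> F0; apply: (big_ind pnonneg) => //; [exact: pnonneg0|exact: pnonnegD]. Qed.

Lemma psupp_sum (J : finType) (P : pred J) (F : J -> mvpoly I R) a :
    (forall j, P j -> pnonneg (F j)) ->
  psupp (\sum_(j | P j) F j) a = [exists j, P j && psupp (F j) a].
Proof.
move=> F0; rewrite /psupp -big_filter mvcoef_sum big_filter nonnil_sum; last first.
  by move=> j /F0.
by apply/hasP/existsP => [[j _ H]|[j H]]; exists j => //; rewrite mem_index_enum.
Qed.

Hypothesis le01 : nonneg (1 : R).

Lemma pnonneg1 : pnonneg 1. Proof. exact: pnonneg_term. Qed.

Lemma psupp1 a : psupp 1 a = (a == 0).
Proof. by rewrite [psupp _ _]psupp_term nonnil1 andbT. Qed.

Lemma pnonneg_prod (J : Type) (s : seq J) (F : J -> mvpoly I R) :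
  (forall j, pnonneg (F j)) -> pnonneg (\prod_(j <- s) F j).
Proof. by move=> F0; apply: (big_ind pnonneg) => //; [exact: pnonneg1|exact: pnonnegM]. Qed.

Lemma psupp_prod (J : finType) (F : J -> mvpoly I R) a :
    (forall j, pnonneg (F j)) ->
  psupp (\prod_j F j) a <->
  exists2 b : J -> mvmonom I, forall j, psupp (F j) (b j) & a = \sum_j b j.
Proof.
move=> F0; suff H s : uniq s -> forall a,
    psupp (\prod_(j <- s) F j) a <->
  exists2 b : J -> mvmonom I, {in s, forall j, psupp (F j) (b j)}
    & a = \sum_(j <- s) b j.
  have [H1 H2] := H _ (index_enum_uniq J) a.
  split=> [/H1[b Fb ->]|[b Fb ->]]; last by apply: (H _ (index_enum_uniq J) _).2; exists b.
  by exists b => // j; apply: Fb; rewrite mem_index_enum.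
elim: s => [_ {}a|j s IH /= /andP[js /IH {}IH] {}a].
  rewrite big_nil psupp1; split=> [/eqP->|[b _ ->]]; last by rewrite big_nil.
  by exists (fun=> 0); rewrite ?big_nil.
rewrite big_cons psuppM ?F0 //; last exact: pnonneg_prod.
split=> [[b [c [Fb /IH[d Fd ->] ->]]]|[b Fb ->]].
  exists (fun i => if i == j then b else d i).
    move=> i; rewrite inE; case: eqP => [->//|_ /=]; exact: Fd.
  rewrite big_cons eqxx; congr (_ + _); apply: eq_big_seq => i si.
  by case: eqP => // ij; rewrite -ij si in js.
exists (b j), (\sum_(i <- s) b i); split; last by rewrite big_cons.
  by apply: Fb; rewrite mem_head.
by apply/IH; exists b => // i si; apply: Fb; rewrite inE si orbT.
Qed.

End Support.

Section Affine.
Variables (I : finType) (R : toSemiRing).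

Definition mvdelta (i : I) : mvmonom I := [ffun j => (j == i : nat)].

Lemma mvaffineE (a0 : R) (a : I -> R) :
  mvaffine a0 a = mvterm 0 a0 + \sum_i mvterm (mvdelta i) (a i).
Proof.
congr (_ + _); apply: eq_bigr => i _.
by rewrite [_ * _]mvmul_term add0r mulr1.
Qed.

Variables (a0 : R) (a : I -> R).
Hypotheses (a0_ge0 : nonneg a0) (a_ge0 : forall i, nonneg (a i)).

Lemma pnonneg_affine : pnonneg (mvaffine a0 a).
Proof.
rewrite mvaffineE; apply: pnonnegD; first exact: pnonneg_term.
by apply: pnonneg_sum => i _; apply: pnonneg_term.
Qed.

Lemma psupp_affine b :
  psupp (mvaffine a0 a) b -> b = 0 \/ exists i, b = mvdelta i.
Proof.
have tn i : pnonneg (mvterm (mvdelta i) (a i)) by apply: pnonneg_term.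
rewrite mvaffineE psuppD; [|exact: pnonneg_term|exact: pnonneg_sum].
case/orP; first by rewrite psupp_term => /andP[/eqP-> _]; left.
rewrite psupp_sum // => /existsP[i /=]; rewrite psupp_term => /andP[/eqP-> _].
by right; exists i.
Qed.

End Affine.

(** * Monomials of permutations, and the support of a projection of the permanent *)

Section Graph.
Variable n : nat.

Definition mvgraph (s : 'S_n) : mvmonom ('I_n * 'I_n)%type :=
  \sum_i mvdelta (i, s i).

Lemma mvgraphE (s : 'S_n) i j : mvgraph s (i, j) = (s i == j : nat).
Proof.
rewrite /mvgraph sum_ffunE (bigD1 i) //= ffunE xpair_eqE eqxx eq_sym big1 ?addr0 //.
by move=> i' ii'; rewrite ffunE xpair_eqE eq_sym (negPf ii').
Qed.

Lemma mvgraph_inj : injective mvgraph.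
Proof.
move=> s t st; apply/permP => i; apply/eqP.
by have := mvgraphE s i (t i); rewrite st mvgraphE eqxx; case: eqP.
Qed.

Lemma prod_mvX (R : comNzSemiRingType) (s : 'S_n) :
  \prod_(i < n) mvX R (i, s i) = mvterm (mvgraph s) 1.
Proof.
rewrite /mvgraph; elim/big_rec2: _ => [//|i b p _ ->].
by rewrite [_ * _]mvmul_term mulr1.
Qed.

End Graph.

Section Subst.
Variables (I J : finType) (R : comNzSemiRingType) (u : J -> mvpoly I R).

Let F (a : mvmonom J) c : mvpoly I R := mvC I c * \prod_j u j ^+ (a : {ffun J -> nat}) j.

Let F0 a : F a 0 = 0. Proof. by rewrite /F /mvC mvterm0 mul0r. Qed.

Lemma mvsubstD p q : mvsubst (p + q) u = mvsubst p u + mvsubst q u.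
Proof.
by apply: (@mvsuppD _ _ p q _ F) => // a c c'; rewrite /F /mvC mvtermD mulrDl.
Qed.

Lemma mvsubst0 : mvsubst 0 u = 0.
Proof.
rewrite /mvsubst big1 // => a _.
by rewrite mvcoef0 /mvC mvterm0 mul0r.
Qed.

Lemma mvsubst_term a c :
  mvsubst (mvterm a c) u = mvC I c * \prod_j u j ^+ (a : {ffun J -> nat}) j.
Proof. exact: (@mvsupp_term _ _ a c _ F). Qed.

End Subst.

Lemma mvsubst_perm (I : finType) (R : comNzSemiRingType) m
    (u : 'I_m * 'I_m -> mvpoly I R) :
  mvsubst (perm_poly R m) u = \sum_(s : 'S_m) \prod_i u (i, s i).
Proof.
rewrite /perm_poly; elim/big_rec2: _ => [|s p q _ <-]; first exact: mvsubst0.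
rewrite mvsubstD prod_mvX mvsubst_term [mvC _ _](_ : _ = 1) // mul1r.
congr (_ + _); rewrite /mvgraph.
under eq_bigr do rewrite sum_ffunE expr_sum.
rewrite exchange_big; apply: eq_bigr => i _ /=.
rewrite (bigD1 (i, s i)) //= ffunE eqxx expr1 big1 ?mulr1 // => j ij.
by rewrite ffunE (negPf ij) expr0.
Qed.

Lemma mvcoef_HC (R : comNzSemiRingType) n (s : 'S_n) :
  full_cycle s -> mvcoef (mvgraph s) (HC_poly R n) = 1.
Proof.
move=> sc; rewrite /HC_poly -big_filter mvcoef_sum big_filter (bigD1 s) //=.
rewrite prod_mvX mvcoef_term eqxx big1 ?addr0 // => t /andP[_ ts].
by rewrite prod_mvX mvcoef_term (inj_eq (@mvgraph_inj n)) eq_sym (negPf ts).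
Qed.

(** Take for [lab i j] the support of the affine form substituted for the variable [(i, j)]:
    supports turn sums into unions and products into sums of exponents. *)
Lemma projection_support (R : toSemiRing) n m (s0 : 'S_n) : (0 < n)%N -> full_cycle s0 ->
  monotone_affine_projection (HC_poly R n) (perm_poly R m) ->
  exists lab : 'I_m -> 'I_m -> pred (mvmonom ('I_n * 'I_n)%type),
  [/\ forall i j b, lab i j b -> b = 0 \/ exists e, b = mvdelta e,
      forall (p : 'S_m) b, (forall i, lab i (p i) (b i)) ->
        exists2 s : 'S_n, full_cycle s & \sum_i b i = mvgraph s
    & forall s : 'S_n, full_cycle s -> exists (p : 'S_m) b,
        (forall i, lab i (p i) (b i)) /\ \sum_i b i = mvgraph s].
Proof.
move=> n0 s0c [a0 [a [a0_ge0 a_ge0]]]; set u := fun j => _.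
rewrite (mvsubst_perm u) => HCE.
(* Otherwise all substituted forms vanish and the projection is constant (it is [1] for [m = 0]),
   whereas [HC_n] has coefficient [1] at the non-constant monomial of [s0]. *)
have le01 : nonneg (1 : R).
  apply: contraT => nle01; have u0 j : u j = 0.
    rewrite /u mvaffineE (nonneg_trivial nle01 (a0_ge0 j)) mvterm0 add0r.
    by rewrite big1 // => i _; rewrite (nonneg_trivial nle01 (a_ge0 j i)) mvterm0.
  have := mvcoef_HC R s0c; rewrite HCE mvcoef_sum big1 => [|p _].
    by move/eqP; rewrite eq_sym (negPf (oner_neq0 _)).
  have [i _|no] := pickP (fun _ : 'I_m => true).
    by rewrite (bigD1 i) //= u0 mul0r mvcoef0.
  rewrite big1 => [|i _]; last by have := no i.
  rewrite mvcoef_term; case: eqP => //.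
  move/(congr1 (fun b : mvmonom _ => b (Ordinal n0, s0 (Ordinal n0)))).
  by rewrite mvgraphE eqxx ffunE.
have un j : pnonneg (u j) by apply: pnonneg_affine.
have mn (s : 'S_n) : pnonneg (mvterm (mvgraph s) (1 : R)) by apply: pnonneg_term.
have HCs b : psupp (HC_poly R n) b <-> exists2 s : 'S_n, full_cycle s & b = mvgraph s.
  rewrite /HC_poly; under eq_bigr do rewrite prod_mvX.
  rewrite psupp_sum //; split=> [/existsP[s /andP[sc]]|[s sc ->]].
    by rewrite psupp_term => /andP[/eqP-> _]; exists s.
  by apply/existsP; exists s; rewrite sc psupp_term eqxx nonnil1.
exists (fun i j => psupp (u (i, j))); split=> [i j b|p b H|s sc].
- exact: psupp_affine.
- have /HCs[s sc sE] : psupp (HC_poly R n) (\sum_i b i); last by exists s.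
  rewrite HCE psupp_sum => [|t _]; last exact: pnonneg_prod.
  by apply/existsP; exists p; apply/psupp_prod => //; exists b.
have : psupp (HC_poly R n) (mvgraph s) by apply/HCs; exists s.
rewrite HCE psupp_sum => [|t _]; last exact: pnonneg_prod.
by case/existsP => p /(psupp_prod le01)[] // b Hb sE; exists p, b.
Qed.

(** * Multigraphs whose perfect matchings are labelled by [1 + perm_k] *)

Section Weight.
Variable k : nat.
Notation L := (mvmonom ('I_k * 'I_k)%type).
Implicit Types (a b z : L) (s : 'S_k).

Definition row_wt b (i : 'I_k) : nat := (\sum_j b (i, j))%N.
Definition col_wt b (j : 'I_k) : nat := (\sum_i b (i, j))%N.
Definition wt b : nat := (\sum_i row_wt b i)%N.

Lemma wt_col b : wt b = (\sum_j col_wt b j)%N.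
Proof. exact: exchange_big. Qed.

Lemma mvmonomD (I : finType) (a b : mvmonom I) i : (a + b) i = (a i + b i)%N.
Proof. by rewrite ffunE. Qed.

Lemma row_wtD a b i : row_wt (a + b) i = (row_wt a i + row_wt b i)%N.
Proof. by rewrite /row_wt -big_split; apply: eq_bigr => j _; rewrite mvmonomD. Qed.

Lemma col_wtD a b j : col_wt (a + b) j = (col_wt a j + col_wt b j)%N.
Proof. by rewrite /col_wt -big_split; apply: eq_bigr => i _; rewrite mvmonomD. Qed.

Lemma wtD a b : wt (a + b) = (wt a + wt b)%N.
Proof. by rewrite /wt -big_split; apply: eq_bigr => i _; rewrite row_wtD. Qed.

Lemma wt0 : wt 0 = 0%N.
Proof. by rewrite /wt big1 // => i _; apply: big1 => j _; rewrite ffunE. Qed.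

Lemma wt_eq0 b : wt b = 0%N -> b = 0.
Proof.
move/eqP; rewrite sum_nat_eq0 => /forallP H; apply/ffunP => -[i j].
by have := H i; rewrite /= sum_nat_eq0 => /forallP/(_ j)/eqP/= ->; rewrite ffunE.
Qed.

Lemma wt_sum (J : Type) (t : seq J) (F : J -> L) :
  wt (\sum_(j <- t) F j) = (\sum_(j <- t) wt (F j))%N.
Proof. by elim/big_rec2: _ => [|j x y _ <-]; rewrite ?wt0 ?wtD. Qed.

Lemma row_wt_graph s i : row_wt (mvgraph s) i = 1%N.
Proof.
rewrite /row_wt (bigD1 (s i)) //= mvgraphE eqxx big1 // => j ji.
by rewrite mvgraphE eq_sym (negPf ji).
Qed.

Lemma col_wt_graph s j : col_wt (mvgraph s) j = 1%N.
Proof.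
rewrite /col_wt (bigD1 (s^-1 j)%g) //= mvgraphE permKV eqxx big1 // => i ij.
by rewrite mvgraphE; case: eqP => // sij; rewrite -sij permK eqxx in ij.
Qed.

Lemma wt_graph s : wt (mvgraph s) = k.
Proof.
by rewrite /wt; under eq_bigr do rewrite row_wt_graph; rewrite sum1_card card_ord.
Qed.

Definition graph_sum z := exists t : seq 'S_k, z = \sum_(s <- t) mvgraph s.

Lemma graph_sum0 : graph_sum 0.
Proof. by exists [::]; rewrite big_nil. Qed.

Lemma graph_sum1 s : graph_sum (mvgraph s).
Proof. by exists [:: s]; rewrite big_seq1. Qed.

Lemma graph_sumD a b : graph_sum a -> graph_sum b -> graph_sum (a + b).
Proof. by move=> [t ->] [t' ->]; exists (t ++ t'); rewrite big_cat. Qed.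

(** Each summand has weight [k], so these bounds leave room for exactly one. *)
Lemma graph_sum_wt z : graph_sum z -> (0 < wt z <= k)%N -> exists s, z = mvgraph s.
Proof.
move=> [t ->]; rewrite wt_sum; under eq_bigr do rewrite wt_graph.
rewrite big_const_seq count_predT iter_addn_0 => /andP[].
case: t => [|s [|s' t]] /= H1 H2; first by rewrite muln0 in H1.
  by exists s; rewrite big_seq1.
by nia.
Qed.

End Weight.

(** Following such a permutation by the inverse of a fixed one [s0] gives a permutation stabilizing
    [X], which is determined by its restrictions to [X] and to the complement. *)
Lemma card_perm_maps (T : finType) (X Y : {set T}) : #|X| = #|Y| ->
  (#|[set s : {perm T} | s @: X \subset Y]| <= #|X| `! * #|~: X| `!)%N.
Proof.
move=> XY; set F := [set s | _].
have [->|[s0]] := set_0Vmem F; first by rewrite cards0.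
have FE s : s \in F -> s @: X = Y.
  by rewrite inE => sXY; apply/eqP; rewrite eqEcard sXY card_imset ?XY //=; apply: perm_inj.
move=> /FE s0X.
pose G s := let r := (s * s0^-1)%g in (restr_perm X r, restr_perm (~: X) r).
have stab s : s \in F -> (s * s0^-1)%g \in 'N(X | 'P)%g.
  move=> /FE sX; apply/astabsP => x /=; rewrite apermE permM.
  rewrite -(mem_imset _ _ (@perm_inj _ s0)) permKV s0X -sX mem_imset //; exact: perm_inj.
have GI : {in F &, injective G}.
  move=> s t sF tF [E1 E2]; apply: (mulIg s0^-1%g); apply/permP => x.
  have [xX|xX] := boolP (x \in X).
    by rewrite -(restr_permE (stab s sF) xX) E1 restr_permE ?stab.
  have xC : x \in ~: X by rewrite inE.
  by rewrite -(restr_permE _ xC) ?astabsC ?stab // E2 restr_permE ?astabsC ?stab.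
rewrite -(card_in_imset GI) -!card_perm -cardX.
apply: subset_leq_card; apply/subsetP => _ /imsetP[s _ ->].
by rewrite inE; apply/andP; split; apply: restr_perm_on.
Qed.

(** * Closed walks, loop erasure and exchange of walks *)

Section Walks.
Variables (m k : nat).
Notation L := (mvmonom ('I_k * 'I_k)%type).
Variable lab : 'I_m -> 'I_m -> pred L.
Hypothesis lab_id : forall i, lab i i 0.
Hypothesis lab_perm : forall (p : 'S_m) b, (forall i, lab i (p i) (b i)) ->
  graph_sum (\sum_i b i).
Hypothesis lab_wt : forall i j b, lab i j b -> (wt b <= 1)%N.

(** One label per source vertex suffices on simple paths, which leave each vertex at most once. *)
Definition step (g : 'I_m -> L) : rel 'I_m := fun x y => lab x y (g x).

(** Loops at all vertices off the cycle complete it to a perfect matching, and by [lab_id] they can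
    be given label [0]. *)
Lemma cycle_graph_sum g c : uniq c -> path.cycle (step g) c ->
  graph_sum (\sum_(x <- c) g x).
Proof.
move=> Uc Cc; have nI : injective (next c) := can_inj (prev_next Uc).
pose b x := if x \in c then g x else 0.
have := @lab_perm (perm nI) b; rewrite (bigID (mem c)) /= addrC big1 ?add0r; last first.
  by move=> x /negPf xc; rewrite /b xc.
rewrite (eq_bigr g) => [|x xc]; last by rewrite /b xc.
rewrite -big_uniq //; apply=> x; rewrite permE /b.
case: (boolP (x \in c)) => xc; first exact: next_cycle Cc xc.
suff -> : next c x = x by apply: lab_id.
by rewrite next_nth (negPf xc).
Qed.

Inductive walk : 'I_m -> 'I_m -> L -> Prop :=
| walk_nil i : walk i i 0
| walk_cons i j l b z : lab i j b -> walk j l z -> walk i l (b + z).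

Lemma walk_cat i j l z z' : walk i j z -> walk j l z' -> walk i l (z + z').
Proof.
elim=> [{}i|{}i i' {}j b {}z Hb _ IH /IH]; first by rewrite add0r.
by rewrite -addrA; apply: walk_cons.
Qed.

(** Induction on the walk: a new first arc either keeps the path simple or closes one simple cycle
    through [i], which is cut off and its label moved into [Z]. *)
Lemma loop_erasure i j z : walk i j z -> exists xs g Z,
  [/\ uniq (i :: xs), path (step g) i xs, last i xs = j, graph_sum Z
    & z = Z + \sum_(x <- belast i xs) g x].
Proof.
elim=> [{}i|{}i l {}j b {}z Hb _ [xs [g [Z [U P E HZ ->]]]]].
  exists [::], (fun=> 0), 0; split=> //; first exact: graph_sum0.
  by rewrite big_nil addr0.
(* Relabelling [i] is harmless along the part of the path that does not leave [i]. *)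
pose g' x := if x == i then b else g x.
have g'E s : i \notin s -> \sum_(x <- s) g' x = \sum_(x <- s) g x.
  move=> si; apply: eq_big_seq => x xs'; rewrite /g'; case: eqP => // xi.
  by rewrite -xi xs' in si.
have g'P x s : i \notin belast x s -> path (step g') x s = path (step g) x s.
  elim: s x => //= y s IH x; rewrite inE negb_or => /andP[xi yi].
  by rewrite IH // /step /g' eq_sym (negPf xi).
have g'i : g' i = b by rewrite /g' eqxx.
have [il|il] := boolP (i \in l :: xs); last first.
  have nb : i \notin belast l xs by apply: contra il; apply: mem_belast.
  exists (l :: xs), g', Z; split=> //=.
  - by rewrite il.
  - by rewrite /step g'i Hb g'P.
  rewrite big_cons g'i g'E //. exact: addrCA.
case/splitPl: il U P E => xs1 xs2 li U; rewrite cat_path last_cat li => /andP[P1 P2] E.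
have [U1 U2] : uniq (l :: xs1) /\ uniq (i :: xs2).
  move: U; rewrite -cat_cons cat_uniq => /and3P[-> /hasPn dis U2]; split=> //=.
  rewrite U2 andbT; apply/negP => /dis; rewrite -li /=; apply/negP/negPn.
  exact: mem_last.
have nb : i \notin belast l xs1.
  by move: U1; rewrite lastI rcons_uniq li => /andP[].
exists xs2, g, (Z + \sum_(x <- i :: belast l xs1) g' x); split=> //.
  apply: graph_sumD => //; apply: cycle_graph_sum.
    by rewrite /= nb; move: U1; rewrite lastI rcons_uniq => /andP[].
  rewrite /= -li -lastI /= /step li g'i Hb /=; rewrite -/(step g') g'P //.
rewrite belast_cat li big_cat big_cons g'i g'E //=.
by rewrite -!addrA; exact: addrCA.
Qed.

(** The simple path that remains after loop erasure runs from [i] to [i], hence is empty. *)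
Lemma closed_walk i z : walk i i z -> graph_sum z.
Proof.
case/loop_erasure => xs [g [Z [U _ E HZ ->]]]; case: xs U E => [|x xs] U E.
  by rewrite big_nil addr0.
by move: U; rewrite -{1}E /= mem_last.
Qed.

Lemma walk_traject (p : 'S_m) b x t : (forall i, lab i (p i) (b i)) ->
  walk x (iter t p x) (\sum_(y <- traject p x t) b y).
Proof.
move=> Hb; elim: t x => [|t IH] x; first by rewrite big_nil; apply: walk_nil.
rewrite iterSr trajectS big_cons; apply: walk_cons (IH _); exact: Hb.
Qed.

Lemma discrete_ivt (f : nat -> nat) N h : f 0%N = 0%N -> (h <= f N)%N ->
  (forall t, f t.+1 <= (f t).+1)%N -> exists2 t, (t <= N)%N & f t = h.
Proof.
move=> f0 hN fS; have ex : exists t, (h <= f t)%N by exists N.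
case: (ex_minnP ex) => t ht tmin; exists t; first exact: tmin.
apply/eqP; rewrite eqn_leq ht andbT; case: t ht tmin => [|t] ht tmin.
  by rewrite f0.
apply: leq_trans (fS t) _; rewrite ltnNge; apply/negP => /tmin; by rewrite ltnn.
Qed.

(** The cycle of [p] through a vertex with non-zero label has a label of weight between [1] and [k]
    that is a sum of graphs, so it already carries all of [mvgraph s]. Each arc has weight at most
    [1], so this cycle can be cut where the weight reaches [h]. *)
Lemma walk_split h (p : 'S_m) b s : (0 < k)%N -> (h <= k)%N ->
    (forall i, lab i (p i) (b i)) -> \sum_i b i = mvgraph s ->
  exists x u A B, [/\ walk x u A, walk u x B, A + B = mvgraph s & wt A = h].
Proof.
move=> k0 hk Hb bs.
have [x bx] : exists x, b x != 0.
  apply/existsP; apply: contraT => /existsPn b0; move: (wt_graph s).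
  by rewrite -bs big1 => [|i _]; [rewrite wt0 => E; rewrite -E in k0|apply/eqP/negPn].
pose N := #|porbit p x|; have Np : iter N p x = x := iter_porbit p x.
pose f t := \sum_(y <- traject p x t) b y.
have fN : f N = mvgraph s.
  have : graph_sum (f N) by apply: (@closed_walk x); rewrite -{2}Np; apply: walk_traject.
  pose rest := \sum_(y | y \notin traject p x N) b y.
  have E : f N + rest = mvgraph s.
    rewrite /f big_uniq /=; last exact: uniq_traject_porbit.
    by rewrite -bs [RHS](bigID (fun y => y \in traject p x N)).
  have Ew : (wt (f N) + wt rest = k)%N.
    by rewrite -wtD E wt_graph.
  have fN0 : (0 < wt (f N))%N.
    rewrite lt0n; apply: contra bx => /eqP/wt_eq0; rewrite /f.
    have : x \in traject p x N by rewrite -porbit_traject porbit_id.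
    move=> xN; rewrite (big_rem x xN) /= => /(congr1 (@wt k)); rewrite wtD wt0 => /eqP.
    by rewrite addn_eq0 => /andP[/eqP/wt_eq0->].
  case/graph_sum_wt; first by rewrite fN0 -{2}Ew leq_addr.
  move=> r fr; have := Ew; rewrite fr wt_graph => /(canRL (addKn _)).
  by rewrite subnn => /wt_eq0 R0; rewrite R0 addr0 fr in E.
have [||t|t tN ft] := @discrete_ivt (fun t => wt (f t)) N h.
- by rewrite /f big_nil wt0.
- by rewrite fN wt_graph.
- by rewrite /f trajectSr big_rcons /= wtD -addn1 leq_add2l; apply: lab_wt (Hb _).
exists x, (iter t p x), (f t), (\sum_(y <- traject p (iter t p x) (N - t)) b y).
split=> //; first exact: walk_traject.
  by have := walk_traject (iter t p x) (N - t) Hb; rewrite -iterD subnK // Np.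
by rewrite -fN /f -big_cat -trajectD subnKC.
Qed.

(* [A + B'] labels a closed walk and has weight [k], hence is the graph of a
   permutation, just like [A' + B']. *)
Lemma walk_exchange h x u s s' A B A' B' :
    wt A = h -> wt A' = h -> (0 < k)%N ->
    walk x u A -> walk u x B -> A + B = mvgraph s ->
    walk x u A' -> walk u x B' -> A' + B' = mvgraph s' ->
  row_wt A =1 row_wt A' /\ col_wt A =1 col_wt A'.
Proof.
move=> wA wA' k0 HA HB AB HA' HB' AB'.
have [r E] : exists r, A + B' = mvgraph r.
  apply: graph_sum_wt; first exact: closed_walk (walk_cat HA HB').
  have := wt_graph s'; rewrite -AB' !wtD wA wA'; lia.
split=> i.
  have := row_wt_graph r i; rewrite -E; have := row_wt_graph s' i; rewrite -AB'.
  rewrite !row_wtD; lia.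
have := col_wt_graph r i; rewrite -E; have := col_wt_graph s' i; rewrite -AB'.
rewrite !col_wtD; lia.
Qed.

Hypothesis lab_graph : forall s : 'S_k, exists (p : 'S_m) b,
  (forall i, lab i (p i) (b i)) /\ \sum_i b i = mvgraph s.

(** Permutations are sorted by the endpoints [(x, u)] of their split. Within one class all first
    halves occupy the same rows [X] and columns [Y], so every permutation of the class maps [X] into
    [Y]. *)
Lemma fact_le_splits h : (0 < k)%N -> (h <= k)%N ->
  (k`! <= m * m * (h`! * (k - h)`!))%N.
Proof.
move=> k0 hk.
have /choice[f fP] : forall s : 'S_k, exists v : ('I_m * 'I_m) * (L * L),
  [/\ walk v.1.1 v.1.2 v.2.1, walk v.1.2 v.1.1 v.2.2,
      v.2.1 + v.2.2 = mvgraph s & wt v.2.1 = h].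
  move=> s; have [p [b [Hb bs]]] := lab_graph s.
  have [x [u [A [B H]]]] := walk_split k0 hk Hb bs.
  by exists ((x, u), (A, B)).
have -> : (k`! = \sum_(v : 'I_m * 'I_m) #|[set s | (f s).1 == v]|)%N.
  rewrite -card_Sn -sum1_card (partition_big (fun s => (f s).1) predT) //=.
  by apply: eq_bigr => v _; rewrite -sum1_card; apply: eq_bigl => s; rewrite inE.
have -> : (m * m = \sum_(v : 'I_m * 'I_m) 1)%N.
  by rewrite sum1_card card_prod card_ord.
rewrite big_distrl /=; apply: leq_sum => v _; rewrite mul1n.
have [->|[s0]] := set_0Vmem [set s | (f s).1 == v]; first by rewrite cards0.
rewrite inE => /eqP fs0; have [HA HB AB wA] := fP s0.
rewrite fs0 in HA HB; set A := (f s0).2.1 in HA AB wA.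
pose X := [set i | row_wt A i != 0%N]; pose Y := [set j | col_wt A j != 0%N].
have r1 i : (row_wt A i <= 1)%N by rewrite -(row_wt_graph s0 i) -AB row_wtD leq_addr.
have c1 i : (col_wt A i <= 1)%N by rewrite -(col_wt_graph s0 i) -AB col_wtD leq_addr.
have cX : #|X| = h.
  rewrite -wA /wt -sum1_card big_mkcond; apply: eq_bigr => i _.
  by rewrite inE; case: (row_wt A i) (r1 i) => [|[]].
have cY : #|Y| = h.
  rewrite -wA wt_col -sum1_card big_mkcond; apply: eq_bigr => i _.
  by rewrite inE; case: (col_wt A i) (c1 i) => [|[]].
have cXc : #|~: X| = (k - h)%N by rewrite cardsCs setCK cX card_ord.
rewrite -cXc -[in h`!]cX; apply: leq_trans (@card_perm_maps _ X Y _); last by rewrite cX.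
apply: subset_leq_card; apply/subsetP => s; rewrite !inE => /eqP fs.
have [HA' HB' AB' wA'] := fP s; rewrite fs in HA' HB'.
have [rE cE] := walk_exchange wA wA' k0 HA HB AB HA' HB' AB'.
(* A non-zero entry [(i, j)] of the first half of [s] lies on the graph of [s], so [s i = j], and
   column [j] is occupied. *)
apply/subsetP => y /imsetP[i]; rewrite inE => iX ->; rewrite inE cE.
move: iX; rewrite rE sum_nat_eq0 => /forallPn[j] /=; rewrite -lt0n => Aij.
have := mvgraphE s i j; rewrite -AB' mvmonomD; case: eqP => [->|_] E; last first.
  by move/eqP: E; rewrite addn_eq0 => /andP[/eqP E _]; rewrite E in Aij.
by rewrite sum_nat_eq0; apply/forallPn; exists i; rewrite /= -lt0n.
Qed.

End Walks.

(** * A digraph whose Hamiltonian cycles encode [1 + perm_k] *)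

Local Open Scope nat_scope.

Lemma full_cycle_porbit n (s : 'S_n) x0 :
  (forall x, x \in porbit s x0) -> full_cycle s.
Proof.
move=> H; have E : porbit s x0 = setT by apply/setP => x; rewrite H inE.
apply/eqP/setP => X; rewrite inE; apply/imsetP/eqP => [[x _ ->]|->].
  by have := H x; rewrite -eq_porbit_mem E => /eqP.
by exists x0.
Qed.

Lemma full_cycle_of_fun n (F : nat -> nat) x0 : x0 < n ->
    (forall v, v < n -> F v < n) ->
    (forall u v, u < n -> v < n -> F u = F v -> u = v) ->
    (forall Q : nat -> Prop, Q x0 -> (forall v, v < n -> Q v -> Q (F v)) ->
       forall v, v < n -> Q v) ->
  exists2 s : 'S_n, full_cycle s & forall x, s x = F x :> nat.
Proof.
move=> x0n Fn Finj Freach; pose G (x : 'I_n) := Ordinal (Fn x (ltn_ord x)).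
have GI : injective G.
  by move=> x y [xy]; apply: val_inj; apply: Finj xy.
exists (perm GI) => [|x]; last by rewrite permE.
apply: (@full_cycle_porbit _ _ (Ordinal x0n)) => x.
pose Q v := forall vn : v < n, Ordinal vn \in porbit (perm GI) (Ordinal x0n).
suff /(_ (ltn_ord x)) : Q x.
  by rewrite (_ : Ordinal _ = x) //; apply: val_inj.
apply: Freach (ltn_ord x) => [vn|v vn Qv Fvn].
  by rewrite (_ : Ordinal vn = Ordinal x0n) ?porbit_id //; apply: val_inj.
have := mem_porbit (perm GI) 1 (Ordinal vn); rewrite expg1 permE.
rewrite (_ : G _ = Ordinal Fvn); last exact: val_inj.
by move: (Qv vn); rewrite -!eq_porbit_mem => /eqP->.
Qed.

Lemma full_cycle_no2 n (s : 'S_n) x : 2 < n -> full_cycle s -> s (s x) != x.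
Proof.
move=> n2 /eqP sc; apply: contraTneq n2 => ssx; rewrite -leqNgt.
have : porbit s x \in porbits s by apply: imset_f.
rewrite sc inE => /eqP xT; rewrite -(card_ord n) -cardsT -xT.
apply: leq_trans (_ : #|[set x; s x]| <= 2); last by rewrite cards2; case: eqP.
apply/subset_leq_card/subsetP => y /porbitP[i ->].
elim: i => [|i]; first by rewrite expg0 perm1 !inE eqxx.
by rewrite expgSr permM !inE => /orP[] /eqP->; rewrite ?ssx eqxx ?orbT.
Qed.

Section Extend.
Variables (n : nat) (s : 'S_n).

(** The identity from [n] on. *)
Definition ext_perm (u : nat) : nat := oapp (fun x : 'I_n => s x : nat) u (insub u).

Lemma ext_permE (x : 'I_n) : ext_perm x = s x.
Proof. by rewrite /ext_perm valK. Qed.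

Lemma ext_perm_lt u : u < n -> ext_perm u < n.
Proof. by move=> un; rewrite -[u]/(val (Ordinal un)) ext_permE. Qed.

End Extend.

Lemma ext_permK n (s : 'S_n) u : u < n -> ext_perm s^-1 (ext_perm s u) = u.
Proof. by move=> un; rewrite -[u in LHS]/(val (Ordinal un)) !ext_permE permK. Qed.

Lemma ext_permKV n (s : 'S_n) u : u < n -> ext_perm s (ext_perm s^-1 u) = u.
Proof. by move=> un; rewrite -[u in LHS]/(val (Ordinal un)) !ext_permE permKV. Qed.

Ltac lia_if := repeat (case: ifP => ?); lia.

Section Gadget.
Variables (n k : nat).
Hypothesis kn : 4 * k < n.

(* The vertices are [b_i = 4 i], [y_i = 4 i + 1], [a_i = 4 i + 2] and
   [w_i = 4 i + 3] for [i < k], then [b_k = 4 k] and padding; the distinguished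
   arcs are the [a_i -> w_j]. The last conjunct concerns [b_i] for [0 < i < k]
   only. Absence of 2-cycles forces the alternatives [y_i -> a_i] and
   [a_i -> y_i] to hold for all [i] simultaneously. *)
Definition gadget_arc (u v : nat) :=
  [&& (u < 4 * k) && (u %% 4 == 2) ==>
        (v == u - 1) || (v < 4 * k) && (v %% 4 == 3),
      (v < 4 * k) && (v %% 4 == 2) ==> (u == v - 1) || (u == v + 2),
      (u < 4 * k) && (u %% 4 == 1) ==> (v == u - 1) || (v == u + 1),
      (v < 4 * k) && (v %% 4 == 1) ==> (u == v - 1) || (u == v + 1)
    & (0 < u < 4 * k) && (u %% 4 == 0) ==> (v == u - 2) || (v == u + 1)].

Lemma gadget_out_a i v : i < k -> gadget_arc (4 * i + 2) v ->
  v = 4 * i + 1 \/ v < 4 * k /\ v %% 4 = 3.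
Proof. by move=> ik /and5P[H _ _ _ _]; lia. Qed.

Lemma gadget_in_a i u : i < k -> gadget_arc u (4 * i + 2) ->
  u = 4 * i + 1 \/ u = 4 * i + 4.
Proof. by move=> ik /and5P[_ H _ _ _]; lia. Qed.

Lemma gadget_out_y i v : i < k -> gadget_arc (4 * i + 1) v ->
  v = 4 * i \/ v = 4 * i + 2.
Proof. by move=> ik /and5P[_ _ H _ _]; lia. Qed.

Lemma gadget_in_y i u : i < k -> gadget_arc u (4 * i + 1) ->
  u = 4 * i \/ u = 4 * i + 2.
Proof. by move=> ik /and5P[_ _ _ H _]; lia. Qed.

Lemma gadget_out_b i v : i.+1 < k -> gadget_arc (4 * i.+1) v ->
  v = 4 * i + 2 \/ v = 4 * i.+1 + 1.
Proof. by move=> ik /and5P[_ _ _ _ H]; lia. Qed.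

(** The only neighbours of [y_i] are [b_i] and [a_i], so without 2-cycles the passage is either
    [b_i y_i a_i], which is [D i], or [a_i y_i b_i]. As [a_i] is entered only from [y_i] or
    [b_(i+1)], the directions at [i] and [i+1] agree. *)
Lemma gadget_dichotomy (f : nat -> nat) :
    (forall u v, u < n -> v < n -> f u = f v -> u = v) ->
    (forall v, v < n -> exists2 u, u < n & f u = v) ->
    (forall u, u < n -> f (f u) <> u) ->
    (forall u, u < n -> gadget_arc u (f u)) ->
  (forall i, i < k -> f (4 * i + 2) = 4 * i + 1) \/
  (forall i, i < k -> f (4 * i + 2) < 4 * k /\ f (4 * i + 2) %% 4 = 3).
Proof.
move=> fI fS f2 fA; pose D i := f (4 * i + 1) = 4 * i + 2.
have bn i : i < k -> 4 * i < n by lia.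
have yn i : i < k -> 4 * i + 1 < n by lia.
have an i : i < k -> 4 * i + 2 < n by lia.
have nD i : i < k -> f (4 * i) = 4 * i + 1 -> D i.
  move=> ik fb; case: (gadget_out_y ik (fA _ (yn i ik))) => // fy.
  by case: (f2 _ (bn i ik)); rewrite fb.
have Db i : i < k -> D i -> f (4 * i) = 4 * i + 1.
  move=> ik Di; have [u un fu] := fS _ (yn i ik).
  have := fA _ un; rewrite fu => /(gadget_in_y ik)[uE|uE].
    by rewrite -fu uE.
  by case: (f2 _ (yn i ik)); rewrite Di -uE.
have back i : i < k -> ~ D i -> f (4 * i + 2) = 4 * i + 1.
  move=> ik nDi; have [u un fu] := fS _ (yn i ik).
  have := fA _ un; rewrite fu => /(gadget_in_y ik)[uE|uE].
    by case: nDi; apply: nD; rewrite // -fu uE.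
  by rewrite -uE.
have fwd i : i < k -> D i -> f (4 * i + 2) < 4 * k /\ f (4 * i + 2) %% 4 = 3.
  move=> ik Di; case: (gadget_out_a ik (fA _ (an i ik))) => // fa.
  by case: (f2 _ (yn i ik)); rewrite Di.
have up i : i.+1 < k -> D i -> D i.+1.
  move=> ik Di; apply: nD => //.
  case: (gadget_out_b ik (fA _ (bn _ ik))) => // fb.
  have := fI _ _ (bn _ ik) (yn _ (ltnW ik)); rewrite fb => /(_ (esym Di)); lia.
have dn i : i.+1 < k -> D i.+1 -> D i.
  move=> ik /(Db _ ik) fb; have [u un fu] := fS _ (an _ (ltnW ik)).
  have := fA _ un; rewrite fu => /(gadget_in_a (ltnW ik))[uE|uE].
    by rewrite /D -uE.
  have uE' : u = 4 * i.+1 by lia.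
  by move: fu; rewrite uE' fb => ?; exfalso; lia.
have D0 i : i < k -> D i <-> D 0.
  elim: i => [//|i IH] ik; rewrite -(IH (ltnW ik)).
  by split; [apply: dn|apply: up].
have [d0|d0] := eqVneq (f (4 * 0 + 1)) (4 * 0 + 2).
  by right=> i ik; apply: fwd => //; apply/D0.
by left=> i ik; apply: back => // /(D0 i ik)/eqP; apply/negP.
Qed.

(* The cycle [b_k a_(k-1) y_(k-1) b_(k-1) .. a_0 y_0 b_0 w_0 .. w_(k-1)], then the
   padding. *)
Definition idle_cycle (v : nat) : nat :=
  if v == 0 then 3 else if (v < 4 * k) && (v %% 4 == 3) then
    if v + 4 < 4 * k then v + 4 else if 4 * k + 1 < n then 4 * k + 1 else 4 * k
  else if v <= 4 * k then (if v %% 4 == 0 then v - 2 else v - 1)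
  else if v + 1 < n then v + 1 else 4 * k.

Lemma idle_cycle_full : 0 < k ->
  exists2 s : 'S_n, full_cycle s & forall x, s x = idle_cycle x :> nat.
Proof.
move=> k0; apply: (@full_cycle_of_fun _ _ (4 * k)) => //.
- by move=> v vn; rewrite /idle_cycle; lia_if.
- by move=> u v un vn; rewrite /idle_cycle; lia_if.
move=> Q Q0 QS.
have step u v : u < n -> Q u -> idle_cycle u = v -> Q v.
  by move=> un Qu <-; apply: QS.
have Qb j : j <= k -> Q (4 * (k - j)).
  elim: j => [|j IH] jk; first by rewrite subn0.
  have Qa : Q (4 * (k - j.+1) + 2).
    by apply: step (IH (ltnW jk)) _; rewrite /idle_cycle; lia_if.
  have Qy : Q (4 * (k - j.+1) + 1) by apply: step Qa _; rewrite /idle_cycle; lia_if.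
  by apply: step Qy _; rewrite /idle_cycle; lia_if.
have Qw j : j < k -> Q (4 * j + 3).
  elim: j => [|j IH] jk; last by apply: step (IH (ltnW jk)) _; rewrite /idle_cycle; lia_if.
  by apply: step (Qb k (leqnn k)) _; rewrite /idle_cycle; lia_if.
have Qt j : 4 * k + j < n -> Q (4 * k + j).
  elim: j => [|[|j] IH] jn; first by rewrite addn0.
    by apply: step (Qw k.-1 _) _; rewrite /idle_cycle; lia_if.
  by apply: step (IH _) _; rewrite /idle_cycle; lia_if.
have Qay i : i < k -> Q (4 * i + 2) /\ Q (4 * i + 1).
  move=> ik; have := Qb (k - i.+1) (leq_subr _ _); rewrite subKn // => Qi.
  have Qa : Q (4 * i + 2) by apply: step Qi _; rewrite /idle_cycle; lia_if.
  by split=> //; apply: step Qa _; rewrite /idle_cycle; lia_if.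
move=> v vn; have [vk|vk] := leqP (4 * k) v.
  by have := Qt (v - 4 * k); rewrite subnKC //; apply.
have ik : v %/ 4 < k by lia.
have := divn_eq v 4; rewrite mulnC; have : v %% 4 < 4 by lia.
case: (v %% 4) => [|[|[|[|//]]]] _ ->.
- by have := Qb (k - v %/ 4) (leq_subr _ _); rewrite subKn 1?ltnW // addn0.
- by case: (Qay _ ik).
- by case: (Qay _ ik).
exact: Qw.
Qed.

Lemma idle_cycle_arc v : 0 < k -> v < n -> gadget_arc v (idle_cycle v).
Proof. by move=> k0 vn; rewrite /gadget_arc /idle_cycle; lia_if. Qed.

Variable s : 'S_k.

(* The cycle [b_0 y_0 a_0 w_(s 0) b_1 y_1 a_1 w_(s 1) .. b_k], then the padding. *)
Definition perm_cycle (v : nat) : nat :=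
  if v < 4 * k then
    if v %% 4 == 2 then 4 * ext_perm s (v %/ 4) + 3
    else if v %% 4 == 3 then 4 * ext_perm s^-1 (v %/ 4) + 4
    else v + 1
  else if v + 1 < n then v + 1 else 0.

Lemma perm_cycle_full :
  exists2 t : 'S_n, full_cycle t & forall x, t x = perm_cycle x :> nat.
Proof.
have lt1 v : v < 4 * k -> ext_perm s (v %/ 4) < k.
  by move=> vk; apply: ext_perm_lt; lia.
have lt2 v : v < 4 * k -> ext_perm s^-1 (v %/ 4) < k.
  by move=> vk; apply: ext_perm_lt; lia.
apply: (@full_cycle_of_fun _ _ 0); first by lia.
- by move=> v vn; rewrite /perm_cycle; have := lt1 v; have := lt2 v; lia_if.
- have eK u v : u < 4 * k -> v < 4 * k ->
      ext_perm s (u %/ 4) = ext_perm s (v %/ 4) -> u %/ 4 = v %/ 4.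
    move=> uk vk /(congr1 (ext_perm s^-1)).
    by rewrite !ext_permK //; lia.
  have eKV u v : u < 4 * k -> v < 4 * k ->
      ext_perm s^-1 (u %/ 4) = ext_perm s^-1 (v %/ 4) -> u %/ 4 = v %/ 4.
    move=> uk vk /(congr1 (ext_perm s)).
    by rewrite !ext_permKV //; lia.
  move=> u v un vn; rewrite /perm_cycle.
  have := lt1 u; have := lt2 u; have := lt1 v; have := lt2 v.
  have := eK u v; have := eKV u v.
  (* Only bounds and injectivity of the values matter from here on. *)
  move: (ext_perm s _) (ext_perm s _) (ext_perm s^-1 _) (ext_perm s^-1 _) => a b c d.
  lia_if.
move=> Q Q0 QS.
have step u v : u < n -> Q u -> perm_cycle u = v -> Q v.
  by move=> un Qu <-; apply: QS.
have dv i r : r < 4 -> (4 * i + r) %/ 4 = i by lia.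
have Qy i : i < k -> Q (4 * i) -> Q (4 * i + 1).
  by move=> ik Qi; apply: step Qi _; rewrite /perm_cycle; lia_if.
have Qa i : i < k -> Q (4 * i) -> Q (4 * i + 2).
  by move=> ik Qi; apply: step (Qy _ ik Qi) _; rewrite /perm_cycle; lia_if.
have Qw i : i < k -> Q (4 * i) -> Q (4 * ext_perm s i + 3).
  move=> ik Qi; apply: step (Qa _ ik Qi) _; first by lia.
  by rewrite /perm_cycle dv // (_ : _ %% 4 = 2) ?ifT //; lia.
have Qb i : i <= k -> Q (4 * i).
  elim: i => [|i IH] ik //.
  apply: step (Qw _ ik (IH (ltnW ik))) _; have := ext_perm_lt s ik => sk; first by lia.
  by rewrite /perm_cycle dv // (_ : _ %% 4 = 3) ?ext_permK // ?ifT //; lia.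
have Qt j : 4 * k + j < n -> Q (4 * k + j).
  elim: j => [|j IH] jn; first by rewrite addn0; apply: Qb.
  by apply: step (IH _) _; rewrite /perm_cycle; lia_if.
move=> v vn; have [vk|vk] := leqP (4 * k) v.
  by have := Qt (v - 4 * k); rewrite subnKC //; apply.
have ik : v %/ 4 < k by lia.
have Qi := Qb _ (ltnW ik).
have := divn_eq v 4; rewrite mulnC; have : v %% 4 < 4 by lia.
case: (v %% 4) => [|[|[|[|//]]]] _ ->.
- by rewrite addn0.
- exact: Qy.
- exact: Qa.
rewrite -(ext_permKV s ik); apply: Qw; last apply: Qb; last apply: ltnW; exact: ext_perm_lt.
Qed.

Lemma perm_cycle_arc v : v < n -> gadget_arc v (perm_cycle v).
Proof.
move=> vn; rewrite /gadget_arc /perm_cycle.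
have := @ext_perm_lt _ s (v %/ 4); have := @ext_perm_lt _ s^-1 (v %/ 4).
lia_if.
Qed.

End Gadget.

Local Close Scope nat_scope.

(** * Transfer from Hamiltonian cycles of the digraph to monomials of [perm_k] *)

Lemma mvmonom_sum_eq0 (I J : finType) (F : J -> mvmonom I) j :
  \sum_i F i = 0 -> F j = 0.
Proof.
move/ffunP => E; apply/ffunP => i; have := E i.
rewrite (bigD1 j) //= mvmonomD [RHS]ffunE => /eqP.
by rewrite addn_eq0 => /andP[/eqP-> _]; rewrite ffunE.
Qed.

Section Letters.
Variables (n k : nat).
Hypothesis kn : (4 * k < n)%N.

Fact out_subproof (i : 'I_k) : (4 * i + 2 < n)%N.
Proof. by have := ltn_ord i; lia. Qed.

Fact in_subproof (j : 'I_k) : (4 * j + 3 < n)%N.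
Proof. by have := ltn_ord j; lia. Qed.

(** On exponents, this substitutes a new variable [(i, j)] for the variable of the arc [a_i -> w_j]
    and [1] for every other variable. *)
Definition letters (b : mvmonom ('I_n * 'I_n)%type) : mvmonom ('I_k * 'I_k)%type :=
  [ffun e => b (Ordinal (out_subproof e.1), Ordinal (in_subproof e.2))].

Lemma letters_sum (J : Type) (t : seq J) F :
  letters (\sum_(j <- t) F j) = \sum_(j <- t) letters (F j).
Proof.
elim/big_rec2: _ => [|j x y _ <-]; apply/ffunP => e; first by rewrite !ffunE.
by rewrite !(ffunE, mvmonomD).
Qed.

Lemma letters0 : letters 0 = 0.
Proof. by apply/ffunP => e; rewrite !ffunE. Qed.

Lemma wt_letters_delta e : (wt (letters (mvdelta e)) <= 1)%N.
Proof.
have [/existsP[[i j] /eqP->]|/existsPn H] := boolP [exists d : 'I_k * 'I_k,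
    e == (Ordinal (out_subproof d.1), Ordinal (in_subproof d.2))]; last first.
  rewrite (_ : letters _ = 0) ?wt0 //; apply/ffunP => d.
  by rewrite !ffunE eq_sym (negPf (H d)).
rewrite (_ : letters _ = mvdelta (i, j)); last first.
  apply/ffunP => -[i' j']; rewrite !ffunE !xpair_eqE /= -!val_eqE /=.
  by congr (nat_of_bool (_ && _)); lia.
rewrite /wt (bigD1 i) //= /row_wt (bigD1 j) //= ffunE eqxx big1 => [|j' jj]; last first.
  by rewrite ffunE xpair_eqE eqxx (negPf jj).
rewrite big1 // => i' ii; rewrite big1 // => j' _.
by rewrite ffunE xpair_eqE (negPf ii).
Qed.

(** By the dichotomy either no distinguished arc is used, or every [a_i] is followed by some [w_j],
    and [i |-> j] is a permutation of [k] points. *)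
Lemma letters_graph (s : 'S_n) : full_cycle s ->
    (forall x : 'I_n, gadget_arc k x (s x)) ->
  graph_sum (letters (mvgraph s)).
Proof.
move=> sc sA; have [k0|k0] := posnP k.
  rewrite (_ : letters _ = 0); first exact: graph_sum0.
  by apply/ffunP => -[i]; have := ltn_ord i; rewrite {2}k0.
have n2 : (2 < n)%N by lia.
have fE (x : 'I_n) : ext_perm s x = s x by apply: ext_permE.
have [|||u un|H|H] := @gadget_dichotomy n k kn (ext_perm s).
- move=> u v un vn /(congr1 (ext_perm s^-1%g)).
  by rewrite !ext_permK.
- move=> v vn; exists (ext_perm s^-1%g v); first exact: ext_perm_lt.
  by rewrite ext_permKV.
- move=> u un; rewrite -[u]/(val (Ordinal un)) !fE => /val_inj/eqP.
  by apply/negP; apply: full_cycle_no2.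
- by have := sA (Ordinal un); rewrite -fE.
- rewrite (_ : letters _ = 0); first exact: graph_sum0.
  apply/ffunP => -[i j]; rewrite !ffunE mvgraphE -val_eqE /= -fE /= H //; lia.
have lt (i : 'I_k) : (ext_perm s (4 * i + 2) %/ 4 < k)%N.
  by have [] := H i (ltn_ord i); lia.
pose sg i := Ordinal (lt i).
have sgI : injective sg.
  move=> i j [] E; apply: val_inj => /=.
  have [_ Hi] := H i (ltn_ord i); have [_ Hj] := H j (ltn_ord j).
  have /(congr1 (ext_perm s^-1%g)) : ext_perm s (4 * i + 2) = ext_perm s (4 * j + 2).
    by rewrite [LHS](divn_eq _ 4) [RHS](divn_eq _ 4) Hi Hj E.
  rewrite !ext_permK ?out_subproof //; lia.
rewrite (_ : letters _ = mvgraph (perm sgI)); first exact: graph_sum1.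
apply/ffunP => -[i j]; rewrite ffunE !mvgraphE permE -!val_eqE /= -fE /=.
by have [Hi1 Hi2] := H i (ltn_ord i); congr nat_of_bool; lia.
Qed.

End Letters.

Lemma HC_projection_fact (R : toSemiRing) n m k h :
    (4 * k < n)%N -> (0 < k)%N -> (h <= k)%N ->
    monotone_affine_projection (HC_poly R n) (perm_poly R m) ->
  (k`! <= m * m * (h`! * (k - h)`!))%N.
Proof.
move=> kn k0 hk HCp; have [s0 s0c s0E] := idle_cycle_full kn k0.
have [|lab [lab1 labS labC]] := @projection_support R n m s0 _ s0c HCp; first by lia.
(* Keeping only these monomials amounts to setting the variables of all non-arcs to [0]. *)
pose ok (b : mvmonom ('I_n * 'I_n)%type) :=
  forall x y : 'I_n, ~~ gadget_arc k x y -> b (x, y) = 0%N.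
have ok_term (b : 'I_m -> mvmonom ('I_n * 'I_n)%type) i : ok (\sum_i b i) -> ok (b i).
  move=> H x y /H; rewrite (bigD1 i) //= mvmonomD => /eqP.
  by rewrite addn_eq0 => /andP[/eqP].
have ok_graph (s : 'S_n) : ok (mvgraph s) <-> forall x : 'I_n, gadget_arc k x (s x).
  split=> [H x|H x y]; last by rewrite mvgraphE; case: eqP => // <-; rewrite H.
  by apply: contraT => /H; rewrite mvgraphE eqxx.
have [p0 [b0 [Hb0 b0E]]] := labC _ s0c.
(* Columns are renumbered by the matching [p0] of the idle cycle, which thereby becomes the identity
   matching. *)
pose lab' i j l := `[< exists b, [/\ lab i (p0 j) b, ok b & letters kn b = l] >].
have lift (p : 'S_m) b : (forall i, lab i (p i) (b i)) -> ok (\sum_i b i) ->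
    forall i, lab' i ((p * p0^-1)%g i) (letters kn (b i)).
  move=> Hb okb i; apply/asboolP; exists (b i); split=> //; last exact: ok_term.
  by rewrite permM permKV.
apply: (@fact_le_splits _ _ lab') => //.
- have ok0 : ok (\sum_i b0 i).
    by rewrite b0E ok_graph => x; rewrite s0E; apply: idle_cycle_arc.
  (* The idle cycle avoids all distinguished arcs; exponents do not cancel, so each single label of
     [p0] becomes [0]. *)
  have E : \sum_i letters kn (b0 i) = 0.
    rewrite -letters_sum b0E; apply/ffunP => -[i j].
    rewrite !ffunE mvgraphE -val_eqE /= s0E /= /idle_cycle.
    have := ltn_ord i; have := ltn_ord j; lia_if.
  move=> i; have := lift _ _ Hb0 ok0 i; rewrite permM permK.
  by rewrite (mvmonom_sum_eq0 i E).
- move=> p l Hl.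
  have /choice[b Hb] i : exists b, [/\ lab i (p0 (p i)) b, ok b & letters kn b = l i].
    exact/asboolP/Hl.
  have [|s sc sE] := labS (p * p0)%g b; first by move=> i; rewrite permM; case: (Hb i).
  have -> : \sum_i l i = letters kn (mvgraph s).
    by rewrite -sE letters_sum; apply: eq_bigr => i _; case: (Hb i).
  apply: letters_graph => //; apply/ok_graph; rewrite -sE => x y xy.
  by rewrite sum_ffunE big1 // => i _; case: (Hb i) => _ /(_ x y xy).
- move=> i j l /asboolP[b [/lab1[->|[e ->]] _ <-]]; last exact: wt_letters_delta.
  by rewrite letters0 wt0.
move=> s; have [t tc tE] := perm_cycle_full kn s.
have [p [b [Hb bE]]] := labC _ tc.
have okb : ok (\sum_i b i).
  by rewrite bE ok_graph => x; rewrite tE; apply: perm_cycle_arc.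
exists (p * p0^-1)%g, (fun i => letters kn (b i)); split; first exact: lift.
rewrite -letters_sum bE; apply/ffunP => -[i j].
rewrite !ffunE !mvgraphE -!val_eqE /= tE /= /perm_cycle.
have := ltn_ord i; have := ltn_ord j => jk ik.
rewrite (_ : (4 * i + 2) %/ 4 = i)%N; last by lia.
rewrite ext_permE; congr nat_of_bool; lia_if.
Qed.

(** * Numerical estimates and the conclusion *)

Lemma bin_double_ge h : (2 ^ h <= 'C(h.*2, h))%N.
Proof.
(* Pascal's rule gives two summands, each at least the previous central coefficient. *)
elim: h => // h IH; rewrite expnS mul2n doubleS binS.
rewrite -addnn leq_add //; first by apply: leq_trans IH _; rewrite binS leq_addl.
by apply: leq_trans IH _; case: h => // h; rewrite binS leq_addr.
Qed.

Lemma HC_projection_expn (R : toSemiRing) n m h :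
    (0 < h)%N -> (8 * h < n)%N ->
    monotone_affine_projection (HC_poly R n) (perm_poly R m) ->
  (2 ^ h <= m ^ 2)%N.
Proof.
move=> h0 hn HCp.
have dh : (h.*2 - h = h)%N by lia.
(* With [k = 2 h] the factorials combine to the central binomial coefficient. *)
have := @HC_projection_fact R n m h.*2 h ltac:(lia) ltac:(lia) ltac:(lia) HCp.
rewrite dh; apply: contraLR; rewrite -!ltnNge => H.
have := @bin_fact h.*2 h ltac:(lia); rewrite dh => <-.
rewrite ltn_pmul2r ?muln_gt0 ?fact_gt0 // mulnn.
exact: leq_trans H (bin_double_ge h).
Qed.

(** For [h = 2 ^ t] a polynomial in [h] is [2] to a linear function of [t], whereas [2 ^ h] is at
    least [2 ^ (t ^ 2)]. *)
Lemma poly_lt_expn c N : exists2 h, (N < h)%N &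
  forall p, (p <= (8 * h + 1) ^ c + c)%N -> (p ^ 2 < 2 ^ h)%N.
Proof.
have exp_sq t : (4 <= t)%N -> (t ^ 2 <= 2 ^ t)%N.
  elim: t => // t IH; rewrite leq_eqVlt => /orP[/eqP[<-]//|t4].
  by rewrite (expnS 2 t); have := IH t4; nia.
(* This choice ensures [2 * ((t + 4) * c + c + 1) <= t ^ 2] and [N < 2 ^ t]. *)
have [t tE] : exists t, t = (4 * c + N + 6)%N by eexists.
have tt : (t < 2 ^ t)%N := ltn_expl t (leqnn 2).
exists (2 ^ t)%N => [|p pc]; first by lia.
have t2 := exp_sq t ltac:(lia).
have H1 : (8 * 2 ^ t + 1 <= 2 ^ (t + 4))%N by rewrite expnD; lia.
have H2 : (p < 2 ^ ((t + 4) * c + c.+1))%N.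
  apply: leq_ltn_trans pc _; rewrite expnD expnM.
  have A : ((8 * 2 ^ t + 1) ^ c <= (2 ^ (t + 4)) ^ c)%N.
    by case: (c) => // d; rewrite leq_exp2r.
  have B : (c.+1 < 2 ^ c.+1)%N := ltn_expl _ (leqnn 2).
  have C : (0 < (2 ^ (t + 4)) ^ c)%N by rewrite !expn_gt0.
  nia.
apply: leq_trans (_ : (2 ^ ((t + 4) * c + c.+1)) ^ 2 <= _)%N; first by rewrite ltn_exp2r.
rewrite -expnM leq_exp2l //; apply: leq_trans t2; nia.
Qed.

Import Num.Theory Order.TTheory.

Theorem theorem4p2 (K : realType) :
  exists eps : K, 0 < eps /\
    forall R : toSemiRing,
      (exists n0 : nat, forall n m : nat, (n0 <= n)%N ->
         monotone_affine_projection (HC_poly R n) (perm_poly R m) ->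
         2 `^ (eps * n%:R) <= m%:R) /\
      ~ monotone_affine_p_projection (HC_poly R) (perm_poly R).
Proof.
(* With [h] the integer part of [(n - 1) / 8], [n >= 16] gives [h >= n / 16]; the square on [m]
   costs another factor [2]. *)
exists 32%:R^-1; split=> [|R]; first by rewrite invr_gt0 ltr0n.
split.
  exists 16%N => n m n16 HCp.
  have H := @HC_projection_expn R n m (n.-1 %/ 8) ltac:(lia) ltac:(lia) HCp.
  rewrite -(ler_pXn2r (n := 2)) ?nnegrE ?powR_ge0 ?ler0n //.
  rewrite -powR_mulrn ?powR_ge0 // -powRrM -natrX.
  apply: le_trans (_ : 2 `^ (n.-1 %/ 8)%N%:R <= _); last first.
    by rewrite powR_mulrn ?ler0n // -natrX ler_nat.
  rewrite ler_powR ?ler1n // -mulrA mulrC ler_pdivrMr ?ltr0n // -!natrM ler_nat.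
  lia.
case=> p [[c pc] [n0 H]].
have [h hn0 hP] := poly_lt_expn c n0.
(* The least [n] with [8 * h < n]. *)
have := H (8 * h + 1)%N ltac:(lia).
move=> /(@HC_projection_expn R (8 * h + 1)%N _ h ltac:(lia) ltac:(lia)).
by rewrite leqNgt hP.
Qed.
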